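(* Let $\omega\in\mathbb{Q}\cap(0,1/2]$. Then, as M\''obius transformations of $\mathbb{Q}(x)\cup\{\infty\}$, $$R_\omega^2=S_\omega,\qquad\text{and}\qquad R_\omega^j\big(\mathcal{V}(\beta_0)\big)=\begin{cases}\mathcal{V}(\beta_j)&\text{if }j\ge0\\-1+\mathcal{V}(\beta_j)&\text{if }j<0\end{cases}$$ for every integer $j$. When regarded as matrices of determinant one ($R_\omega$ being rescaled by a square root of its determinant), $S_\omega=-R_\omega^2$; equivalently, with the matrix representatives given in the context, $R_\omega^2=-d_{\mathcal Q}(\omega)\,S_\omega$.
   Context: $\mathbb{Q}_0=\mathbb{Q}\cap[0,1]$, $\widehat{\mathbb{Q}}_0=\mathbb{Q}_0\cup\{\infty\}$; fractions are in lowest terms with positive denominator, $0=0/1$, $1=1/1$, $\infty=1/0$. A pair $\{p/q,r/s\}\subset\widehat{\mathbb{Q}}_0$ is a Farey pair if $ps-rq=\pm1$; $p/q\oplus r/s=(p+r)/(q+s)$; $\gamma\oplus^0\beta=\gamma$, $\gamma\oplus^j\beta=(\gamma\oplus^{j-1}\beta)\oplus\beta$. $d_{\mathcal Q}(p/q)=(-1)^px^q$. $\mathcal{Q},\mathcal{N}:\widehat{\mathbb{Q}}_0\to\mathbb{Z}[x]$ are the unique functions with $\mathcal{Q}(0)=1,\mathcal{Q}(\infty)=0,\mathcal{Q}(1)=1$, $\mathcal{N}(0)=\mathcal{N}(\infty)=\mathcal{N}(1)=1$, and $\mathcal{F}(\gamma\oplus^2\beta)=-d_{\mathcal Q}(\beta)\mathcal{F}(\gamma)+\mathcal{Q}(\beta)\mathcal{F}(\gamma\oplus\beta)$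 for $\mathcal F\in\{\mathcal Q,\mathcal N\}$ and every Farey pair $\{\beta,\gamma\}$ with $\gamma\oplus^2\beta\in\mathbb{Q}_0$. Put $\mathcal{V}=\mathcal{N}/\mathcal{Q}$. For $\omega\in\mathbb{Q}\cap(0,1/2]$ let $\beta_{-1}<\omega<\beta_0$ be the Farey pair in $\mathbb{Q}_0$ with $\beta_{-1}\oplus\beta_0=\omega$ (the corners of the Stern--Brocot triangle of $\omega$), $\beta_j=\beta_0\oplus^j\omega$ for $j\ge0$ and $\beta_j=\beta_{-1}\oplus^{-1-j}\omega$ for $j<0$. Write $d=d_{\mathcal Q}(\omega)$, $Q=\mathcal{Q}(\omega)$, $N=\mathcal{N}(\omega)$, $N_j=\mathcal{N}(\beta_j)$, $Q_j=\mathcal{Q}(\beta_j)$ and $$X_\omega=\begin{bmatrix}0&1\\-d&Q\end{bmatrix},\qquad Y_\omega=\begin{bmatrix}-dN_0&N_1\\-dQ_0&Q_1\end{bmatrix},\qquad R_\omega=Y_\omega X_\omega Y_\omega^{-1},$$ $$S_\omega=\frac1d\begin{bmatrix}-NQ+d&N^2-NQ+d\\-Q^2&-Q^2+NQ+d\end{bmatrix}\in\mathrm{SL}_2(\mathbb{Q}(x)).$$ ($X_\omega$ is the recursion matrix of $\mathcal{Q}$ and $\mathcal{N}$ at $\omega$, and $S_\omega$ is the $\omega$-crossing loop.) The matrix $R_\omega$ has determinant $d$. *)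

(* Defs.v *)
From HB Require Import structures.
From mathcomp Require Import all_boot all_order all_algebra.

Set Implicit Arguments.
Unset Strict Implicit.
Unset Printing Implicit Defensive.

Import Order.TTheory GRing.Theory Num.Theory.
Local Open Scope ring_scope.

(* Points of QQ U {oo} are terms of [option rat], with [None] for oo = 1/0. *)

Definition num (g : option rat) : int := if g is Some r then numq r else 1.
Definition den (g : option rat) : int := if g is Some r then denq r else 0.

Definition inQ0 (g : option rat) : bool :=
  if g is Some r then 0 <= r <= 1 else false.

Definition inQ0hat (g : option rat) : bool :=
  if g is Some r then 0 <= r <= 1 else true.

Definition farey_pair (g h : option rat) : Prop :=
  [/\ inQ0hat g, inQ0hat h &
      num g * den h - num h * den g = 1 \/
      num g * den h - num h * den g = -1].

Definition oplus (g h : option rat) : option rat :=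
  let q := den g + den h in
  if q == 0 then None else Some ((num g + num h)%:~R / q%:~R).

(* [oplusn g j h] is g (+)^j h, i.e. (...((g (+) h) (+) h)...) (+) h. *)
Definition oplusn (g : option rat) (j : nat) (h : option rat) : option rat :=
  iter j (fun a => oplus a h) g.

(* On QQ0hat numerators and denominators are nonnegative, so the absolute
   values only serve to turn them into natural exponents. *)
Definition dQ (g : option rat) : {poly int} :=
  (-1) ^+ `|num g|%N *: 'X^`|den g|%N.

Definition farey_recursive (Q F : option rat -> {poly int}) : Prop :=
  forall beta gamma : option rat,
    farey_pair beta gamma -> inQ0 (oplusn gamma 2 beta) ->
    F (oplusn gamma 2 beta) =
      - dQ beta * F gamma + Q beta * F (oplus gamma beta).

(* The defining properties of the pair (Q, N).  They determine both functions
   on QQ0hat; the values outside QQ0hat are unconstrained and never used. *)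
Record is_QN (Q N : option rat -> {poly int}) : Prop := IsQN {
  Q_at0 : Q (Some 0) = 1;
  Q_atoo : Q None = 0;
  Q_at1 : Q (Some 1) = 1;
  N_at0 : N (Some 0) = 1;
  N_atoo : N None = 1;
  N_at1 : N (Some 1) = 1;
  Q_rec : farey_recursive Q Q;
  N_rec : farey_recursive Q N
}.

(* The field QQ(x), and the inclusion of ZZ[x] into it. *)
Notation Qx := {fraction {poly rat}}.
Definition toQx (p : {poly int}) : Qx := tofrac (map_poly intr p : {poly rat}).

(* The projective line K U {oo} is [option K], with [None] for oo. *)
Definition proj_ratio (K : fieldType) (a b : K) : option K :=
  if b == 0 then None else Some (a / b).

Definition moebius (K : fieldType) (M : 'M[K]_2) (z : option K) : option K :=
  if z is Some t
  then proj_ratio (M 0 0 * t + M 0 1) (M 1 0 * t + M 1 1)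
  else proj_ratio (M 0 0) (M 1 0).

Definition mx2 (K : fieldType) (a b c d : K) : 'M[K]_2 :=
  \matrix_(i < 2, j < 2)
    if i == 0 then (if j == 0 then a else b) else (if j == 0 then c else d).

Definition VV (Q N : option rat -> {poly int}) (g : option rat) : option Qx :=
  proj_ratio (toQx (N g)) (toQx (Q g)).

Definition corners (w bm1 b0 : rat) : Prop :=
  [/\ inQ0 (Some bm1), inQ0 (Some b0), farey_pair (Some bm1) (Some b0),
      bm1 < w < b0 & oplus (Some bm1) (Some b0) = Some w].

(* [Negz n] is -(n + 1), so -1 - j = n when j = Negz n. *)
Definition beta_seq (w bm1 b0 : rat) (j : int) : option rat :=
  match j with
  | Posz n => oplusn (Some b0) n (Some w)
  | Negz n => oplusn (Some bm1) n (Some w)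
  end.

Section Matrices.
Variables (Q N : option rat -> {poly int}) (w bm1 b0 : rat).

Let d := toQx (dQ (Some w)).
Let q := toQx (Q (Some w)).
Let n := toQx (N (Some w)).
Let Nj (j : int) := toQx (N (beta_seq w bm1 b0 j)).
Let Qj (j : int) := toQx (Q (beta_seq w bm1 b0 j)).

Definition X_mx : 'M[Qx]_2 := mx2 0 1 (- d) q.

Definition Y_mx : 'M[Qx]_2 :=
  mx2 (- d * Nj 0) (Nj 1) (- d * Qj 0) (Qj 1).

Definition R_mx : 'M[Qx]_2 := Y_mx *m X_mx *m invmx Y_mx.

Definition S_mx : 'M[Qx]_2 :=
  d^-1 *: mx2 (- n * q + d)  (n ^+ 2 - n * q + d)
              (- q ^+ 2)     (- q ^+ 2 + n * q + d).

End Matrices.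

(* Main.v *)
Require Import Defs.
From HB Require Import structures.
From mathcomp Require Import all_boot all_order all_algebra ring zify.

(** Write F(g) for the column (N(g), Q(g)).  For a Farey pair g < h with mediant
    m, put W(g, h) = N(g) Q(h) - N(h) Q(g).  Three identities hold at every
    triangle of the Stern-Brocot tree:
      Q(m) = Q(g) Q(h) - W(g, h),
      W(g, m) = d(g) Q(h),    W(m, h) = d(h) Q(g).
    They hold for (0, 1, 1/2), and the recursion together with the
    multiplicativity of d carries them from a triangle to its two children;
    the lemma is [farey_triangle].  The same induction shows that every Q(g)
    has constant term 1; with d a monomial, no denominator vanishes.

    At the triangle of the mediant w the identities say that the matrix
      H = [ n, -(n^2 - n q + d)/q ; q, q - n ],
    where n, q, d are N, Q and d at w, sends F(beta_0) to F(beta_1)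
    ([half_crossing_forward]).  Since H has trace q and determinant d,
    Cayley-Hamilton reads H^2 = q H - d, which is the recursion satisfied by
    F(beta_j).  Hence H^j F(beta_0) = F(beta_j) for j >= 0, and H Y = Y X, so
    that H is R.  Moreover q H - d is, entry by entry, -d S.

    For negative j the columns F'(g) = (N(g) - Q(g), Q(g)) replace F(g): as a
    point of the projective line F' is V - 1.  The identities also give
    H F'(beta_(-1)) = d(beta_(-1)) F(beta_0) ([half_crossing_backward]).  The
    adjugate q - H = d H^(-1) has the same trace and determinant as H, so its
    powers follow the same recursion, which is that of the F'(beta_j) for
    j < 0. *)

Set Implicit Arguments.
Unset Strict Implicit.
Unset Printing Implicit Defensive.

Import Order.TTheory GRing.Theory Num.Theory.
Local Open Scope ring_scope.

(** * Farey pairs as quadruples of naturals *)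

Definition fracpt (a b : nat) : option rat := Some (a%:Q / b%:Q).

(** Natural numerators and denominators make the descent in the Stern-Brocot
    tree accessible to linear arithmetic; the determinant condition implies
    that both fractions are in lowest terms. *)
Definition farey_lt (a b c d : nat) : Prop :=
  [/\ 0 < b, 0 < d, a <= b, c <= d & c * b = (a * d).+1]%N.

Lemma farey_lt_left_half a b c d :
  farey_lt a b c d -> farey_lt a b (a + c) (b + d).
Proof. by case=> *; split; nia. Qed.

Lemma farey_lt_right_half a b c d :
  farey_lt a b c d -> farey_lt (a + c) (b + d) c d.
Proof. by case=> *; split; nia. Qed.

(** Stern-Brocot induction: if b < d then the larger endpoint c/d is itself the
    mediant of a/b and (c - a)/(d - b), and symmetrically if d < b; equality of
    the denominators leaves only the pair 0/1 < 1/1. *)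
Lemma farey_lt_ind (P : nat -> nat -> nat -> nat -> Prop) :
    P 0 1 1 1 ->
    (forall a b c d, farey_lt a b c d -> P a b c d ->
       P a b (a + c)%N (b + d)%N) ->
    (forall a b c d, farey_lt a b c d -> P a b c d ->
       P (a + c)%N (b + d)%N c d) ->
  forall a b c d, farey_lt a b c d -> P a b c d.
Proof.
move=> P0 Pr Pl a b c d.
move: {2}(b + d)%N (leqnn (b + d)) => n.
elim: n a b c d => [|n IHn] a b c d le_bd abcd.
  by case: abcd => *; lia.
case: (abcd) => b0 d0 ab cd det; have [lt_bd|lt_db|eq_bd] := ltngtP b d.
- have abe : farey_lt a b (c - a) (d - b) by split; nia.
  have := Pr _ _ _ _ abe (IHn _ _ _ _ _ abe).
  have -> : (a + (c - a))%N = c by nia.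
  have -> : (b + (d - b))%N = d by lia.
  by apply; lia.
- have ecd : farey_lt (a - c) (b - d) c d by split; nia.
  have := Pl _ _ _ _ ecd (IHn _ _ _ _ _ ecd).
  have -> : (a - c + c)%N = a by nia.
  have -> : (b - d + d)%N = b by lia.
  by apply; lia.
- have /eqP : (b * (c - a) = 1)%N by nia.
  rewrite muln_eq1 => /andP[/eqP b1 /eqP ca].
  by have [-> -> -> ->] : [/\ a = 0, b = 1, c = 1 & d = 1]%N by split; lia.
Qed.

Lemma farey_lt_coprime a b c d :
  farey_lt a b c d -> coprime a b /\ coprime c d.
Proof.
case=> b0 d0 ab cd det; split.
  rewrite coprime_sym; apply/coprimeP => //.
  by exists (c, d); rewrite /= det mulnC; lia.
apply/coprimeP; first by nia.
by exists (b, a); rewrite /= mulnC det; lia.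
Qed.

Lemma num_frac a b : (0 < b)%N -> coprime a b -> num (fracpt a b) = a.
Proof. by move=> b0 cop; rewrite /= coprimeq_num // gtr0_sg ?mul1r. Qed.

Lemma den_frac a b : (0 < b)%N -> coprime a b -> den (fracpt a b) = b.
Proof.
by move=> b0 cop; rewrite /= coprimeq_den //; case: eqP => //; lia.
Qed.

Lemma fracE (r : rat) : 0 <= r -> Some r = fracpt `|numq r| `|denq r|.
Proof.
move=> r0; rewrite /fracpt !absz_denq.
by rewrite gez0_abs ?numq_ge0 // divq_num_den.
Qed.

Lemma inQ0_frac a b : (0 < b)%N -> (a <= b)%N -> inQ0 (fracpt a b).
Proof.
move=> b0 ab; rewrite /= divr_ge0 ?ler0z //=.
by rewrite ler_pdivrMr ?ltr0z // mul1r ler_int.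
Qed.

Lemma oplus_frac a b c d : (0 < b)%N -> (0 < d)%N ->
  coprime a b -> coprime c d ->
  oplus (fracpt a b) (fracpt c d) = fracpt (a + c) (b + d).
Proof.
move=> b0 d0 cop_ab cop_cd; rewrite /oplus !den_frac // !num_frac // -!PoszD.
by case: eqP => //; lia.
Qed.

Lemma farey_lt_oplus a b c d : farey_lt a b c d ->
  oplus (fracpt a b) (fracpt c d) = fracpt (a + c) (b + d).
Proof.
move=> abcd; have [? ?] := farey_lt_coprime abcd.
by case: abcd => *; apply: oplus_frac.
Qed.

Lemma oplusC g h : oplus g h = oplus h g.
Proof. by rewrite /oplus addrC [num g + _]addrC. Qed.

Lemma farey_pair_frac a b c d : farey_lt a b c d ->
  farey_pair (fracpt a b) (fracpt c d) /\ farey_pair (fracpt c d) (fracpt a b).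
Proof.
move=> abcd; have [? ?] := farey_lt_coprime abcd; case: abcd => *.
split; split; rewrite ?num_frac ?den_frac //; try exact: inQ0_frac; lia.
Qed.

Lemma corners_frac w bm1 b0 : corners w bm1 b0 ->
  exists a b c d, [/\ farey_lt a b c d, Some bm1 = fracpt a b,
    Some b0 = fracpt c d & Some w = fracpt (a + c) (b + d)].
Proof.
case=> /andP[a0 a1] /andP[c0 c1] [_ _ det] /andP[ltaw ltwc] ow.
have ltac := lt_trans ltaw ltwc.
have {}det : numq b0 * denq bm1 = numq bm1 * denq b0 + 1.
  move: det ltac => /= det; rewrite -{1}(divq_num_den bm1) -{1}(divq_num_den b0).
  rewrite ltr_pdivrMr ?ltr0z // mulrAC ltr_pdivlMr ?ltr0z //.
  by rewrite -!intrM ltr_int; lia.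
have le_nd (r : rat) : 0 <= r -> r <= 1 -> (`|numq r| <= `|denq r|)%N.
  move=> r0; rewrite -{1}(divq_num_den r) ler_pdivrMr ?ltr0z // mul1r ler_int.
  by have := denq_gt0 r; have := numq_ge0 r; rewrite r0; lia.
have abcd : farey_lt `|numq bm1| `|denq bm1| `|numq b0| `|denq b0|.
  have := numq_ge0 bm1; have := numq_ge0 b0; rewrite a0 c0.
  have := denq_gt0 bm1; have := denq_gt0 b0 => *.
  by split; [lia|lia|exact: le_nd|exact: le_nd|nia].
exists `|numq bm1|%N, `|denq bm1|%N, `|numq b0|%N, `|denq b0|%N.
split=> //; try exact: fracE.
by rewrite -ow (fracE a0) (fracE c0) farey_lt_oplus.
Qed.

Lemma dQ_frac a b : (0 < b)%N -> coprime a b ->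
  dQ (fracpt a b) = (-1) ^+ a *: 'X^b.
Proof. by move=> b0 cop; rewrite /dQ num_frac // den_frac. Qed.

Lemma dQ_mediant a b c d : farey_lt a b c d ->
  dQ (fracpt (a + c) (b + d)) = dQ (fracpt a b) * dQ (fracpt c d).
Proof.
move=> abcd; have [cop_ab cop_cd] := farey_lt_coprime abcd.
have [_ cop_m] := farey_lt_coprime (farey_lt_left_half abcd).
case: abcd => b0 d0 _ _ _; rewrite !dQ_frac ?addn_gt0 ?b0 //.
by rewrite -scalerAl -scalerAr scalerA !exprD.
Qed.

(** Unordered Farey pairs in [0, 1], so that the fans on the two sides of w
    can be treated together. *)
Variant neighbours : option rat -> option rat -> Prop :=
  | NeighbourRight a b c d of farey_lt a b c d :
      neighbours (fracpt a b) (fracpt c d)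
  | NeighbourLeft a b c d of farey_lt a b c d :
      neighbours (fracpt c d) (fracpt a b).

Lemma neighbours_oplus g h : neighbours g h -> neighbours (oplus g h) h.
Proof.
case=> a b c d abcd; last rewrite oplusC; rewrite (farey_lt_oplus abcd).
  exact: NeighbourRight (farey_lt_right_half abcd).
exact: NeighbourLeft (farey_lt_left_half abcd).
Qed.

Lemma neighbours_oplusn g h k : neighbours g h -> neighbours (oplusn g k h) h.
Proof. by move=> gh; elim: k => // k; apply: neighbours_oplus. Qed.

Lemma neighbours_inQ0 g h : neighbours g h -> inQ0 g.
Proof. by case=> a b c d [b0 d0 ab cd _]; apply: inQ0_frac. Qed.

Lemma neighbours_rec Q F g h : farey_recursive Q F -> neighbours g h ->
  F (oplus (oplus g h) h) = - dQ h * F g + Q h * F (oplus g h).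
Proof.
move=> Frec gh; apply: (Frec h g).
  by case: gh => a b c d /farey_pair_frac[].
exact: neighbours_inQ0 (neighbours_oplus (neighbours_oplus gh)).
Qed.

Lemma rec_towards_left Q F a b c d : farey_recursive Q F -> farey_lt a b c d ->
  F (fracpt (a + (a + c)) (b + (b + d))) =
    - dQ (fracpt a b) * F (fracpt c d) +
    Q (fracpt a b) * F (fracpt (a + c) (b + d)).
Proof.
move=> Frec abcd.
rewrite -(farey_lt_oplus (farey_lt_left_half abcd)) -(farey_lt_oplus abcd).
rewrite oplusC [oplus _ (fracpt c d)]oplusC.
exact: neighbours_rec (NeighbourLeft abcd).
Qed.

Lemma rec_towards_right Q F a b c d : farey_recursive Q F -> farey_lt a b c d ->
  F (fracpt (a + c + c) (b + d + d)) =
    - dQ (fracpt c d) * F (fracpt a b) +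
    Q (fracpt c d) * F (fracpt (a + c) (b + d)).
Proof.
move=> Frec abcd.
rewrite -(farey_lt_oplus (farey_lt_right_half abcd)) -(farey_lt_oplus abcd).
exact: neighbours_rec (NeighbourRight abcd).
Qed.

(** * The identities at a Stern-Brocot triangle *)

(** The numerator of V(g) - V(h). *)
Definition cross (Q N : option rat -> {poly int}) g h :=
  N g * Q h - N h * Q g.

Record triangle_identities Q N (g h m : option rat) : Prop :=
  TriangleIdentities {
  Q_mediant : Q m = Q g * Q h - cross Q N g h;
  cross_left : cross Q N g m = dQ g * Q h;
  cross_right : cross Q N m h = dQ h * Q g;
  Q_left0 : (Q g).[0] = 1;
  Q_right0 : (Q h).[0] = 1;
  Q_mediant0 : (Q m).[0] = 1
}.

Lemma frac01 : fracpt 0 1 = Some 0. Proof. by []. Qed.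
Lemma frac11 : fracpt 1 1 = Some 1. Proof. by []. Qed.

Lemma dQ_frac0 a b : (0 < b)%N -> coprime a b -> (dQ (fracpt a b)).[0] = 0.
Proof.
by move=> b0 cop; rewrite dQ_frac // hornerZ hornerXn expr0n gtn_eqF // mulr0.
Qed.

(** The instance of the recursion that involves oo: 1/2 is reached from oo
    by adding 0 twice, passing through 1. *)
Lemma rec_half Q F : farey_recursive Q F ->
  F (fracpt 1 2) = - dQ (fracpt 0 1) * F None + Q (fracpt 0 1) * F (fracpt 1 1).
Proof. by move=> Frec; apply: (Frec (Some 0) None) => //; split=> //; right. Qed.

(** For the left child (g, m) of (g, h), the recursion F(m') = -d(g) F(h) +
    Q(g) F(m) turns the formula for Q(m') into the known value of W(g, m), and
    gives W(g, m') = -d(g) W(g, h) + Q(g) W(g, m) = d(g) Q(m) and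
    W(m', m) = d(g) W(m, h) = d(m) Q(g).  The right child is symmetric. *)
Lemma farey_triangle Q N a b c d : is_QN Q N -> farey_lt a b c d ->
  triangle_identities Q N (fracpt a b) (fracpt c d) (fracpt (a + c) (b + d)).
Proof.
case=> Q0 Qoo Q1 N0 Noo N1 Qrec Nrec; move: a b c d.
apply: farey_lt_ind => [|a b c d abcd|a b c d abcd].
- have d0 : dQ (fracpt 0 1) = 'X by rewrite dQ_frac // scale1r.
  have d1 : dQ (fracpt 1 1) = - 'X by rewrite dQ_frac // scaleN1r.
  have := rec_half Qrec; have := rec_half Nrec.
  rewrite Qoo Noo d0 !frac01 !frac11 Q0 Q1 N1 => Nh Qh.
  have {}Qh : Q (fracpt 1 2) = 1 by rewrite Qh; ring.
  by split; rewrite /cross ?d0 ?d1 ?frac01 ?frac11 ?Qh ?Nh ?Q0 ?Q1 ?N0 ?N1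
                    ?hornerC //; ring.
- move=> [Qm Wl Wr Q0l Q0r Q0m].
  have [cop_ab cop_cd] := farey_lt_coprime abcd.
  have [b0 d0 _ _ _] := abcd.
  have Qmm := rec_towards_left Qrec abcd; have Nmm := rec_towards_left Nrec abcd.
  have dm := dQ_mediant abcd.
  split=> //; rewrite /cross ?Nmm ?Qmm ?dm.
  + by rewrite -[N _ * _ - _]/(cross _ _ _ _) Wl; ring.
  + transitivity (- dQ (fracpt a b) * cross Q N (fracpt a b) (fracpt c d) +
      Q (fracpt a b) * cross Q N (fracpt a b) (fracpt (a + c) (b + d))).
      by rewrite /cross; ring.
    by rewrite Wl Qm; ring.
  + transitivity (dQ (fracpt a b) *
      cross Q N (fracpt (a + c) (b + d)) (fracpt c d)).
      by rewrite /cross; ring.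
    by rewrite Wr; ring.
  + by rewrite !(hornerD, hornerN, hornerM) dQ_frac0 // Q0l Q0m; ring.
- move=> [Qm Wl Wr Q0l Q0r Q0m].
  have [cop_ab cop_cd] := farey_lt_coprime abcd.
  have [b0 d0 _ _ _] := abcd.
  have Qmm := rec_towards_right Qrec abcd; have Nmm := rec_towards_right Nrec abcd.
  have dm := dQ_mediant abcd.
  split=> //; rewrite /cross ?Nmm ?Qmm ?dm.
  + by rewrite -[N _ * _ - _]/(cross _ _ _ _) Wr; ring.
  + transitivity (dQ (fracpt c d) *
      cross Q N (fracpt a b) (fracpt (a + c) (b + d))).
      by rewrite /cross; ring.
    by rewrite Wl; ring.
  + transitivity (- dQ (fracpt c d) * cross Q N (fracpt a b) (fracpt c d) +
      Q (fracpt c d) * cross Q N (fracpt (a + c) (b + d)) (fracpt c d)).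
      by rewrite /cross; ring.
    by rewrite Wr Qm; ring.
  + by rewrite !(hornerD, hornerN, hornerM) dQ_frac0 // Q0r Q0m; ring.
Qed.

(** * Moebius transformations and two-by-two matrices *)

Section Mx2.
Variable K : fieldType.
Implicit Types (a b c d x y : K) (M : 'M[K]_2).

Definition vec2 x y : 'cV[K]_2 := \col_i (if i == 0 then x else y).
Definition point (v : 'cV[K]_2) : option K := proj_ratio (v 0 0) (v 1 0).

Lemma lift01 : lift ord0 ord0 = 1 :> 'I_2. Proof. exact/val_inj. Qed.
Lemma lift10 : lift 1 ord0 = 0 :> 'I_2. Proof. exact/val_inj. Qed.

Lemma ord2P (P : 'I_2 -> Prop) : P 0 -> P 1 -> forall i, P i.
Proof.
by move=> P0 P1 i; case: (unliftP 0 i) => [k ->|-> //]; rewrite (ord1 k) lift01.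
Qed.

Lemma mx2_ext M M' : M 0 0 = M' 0 0 -> M 0 1 = M' 0 1 ->
  M 1 0 = M' 1 0 -> M 1 1 = M' 1 1 -> M = M'.
Proof.
by move=> e00 e01 e10 e11; apply/matrixP; apply: ord2P; apply: ord2P.
Qed.

Lemma cV2_ext (u v : 'cV[K]_2) : u 0 0 = v 0 0 -> u 1 0 = v 1 0 -> u = v.
Proof.
by move=> e0 e1; apply/matrixP; apply: ord2P => j; rewrite ord1.
Qed.

Lemma mulmx2E n (M : 'M[K]_2) (B : 'M[K]_(2, n)) i j :
  (M *m B) i j = M i 0 * B 0 j + M i 1 * B 1 j.
Proof. by rewrite mxE !big_ord_recl big_ord0 addr0 lift01. Qed.

Lemma det_mx22 M : \det M = M 0 0 * M 1 1 - M 0 1 * M 1 0.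
Proof.
rewrite (expand_det_row _ 0) !big_ord_recl big_ord0 addr0 /cofactor !det_mx11.
by rewrite !mxE lift01 lift10 /= expr0 expr1 mul1r mulN1r mulrN.
Qed.

Lemma proj_ratioZ k x y : k != 0 -> proj_ratio (k * x) (k * y) = proj_ratio x y.
Proof.
move=> k0; rewrite /proj_ratio mulf_eq0 (negPf k0) /=.
by case: eqP => // /eqP y0; congr Some; field; rewrite k0 y0.
Qed.

Lemma pointZ k (v : 'cV[K]_2) : k != 0 -> point (k *: v) = point v.
Proof. by move=> k0; rewrite /point !mxE proj_ratioZ. Qed.

Lemma moebius_point M (v : 'cV[K]_2) : v 1 0 != 0 ->
  moebius M (point v) = point (M *m v).
Proof.
move=> v0; rewrite /point {1}/proj_ratio (negPf v0) /= -(proj_ratioZ _ _ v0).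
by rewrite !mulmx2E; congr proj_ratio; field.
Qed.

Lemma moebiusZ k M : k != 0 -> moebius (k *: M) =1 moebius M.
Proof.
move=> k0 [t|]; rewrite /= !mxE ?proj_ratioZ //.
by rewrite -!mulrA -!mulrDr proj_ratioZ.
Qed.

(** By Cayley-Hamilton the orbit of a vector under A satisfies the linear
    recurrence with coefficients trace and determinant, so it is determined by
    its first two terms. *)
Lemma pow_mulmx_recurrence (A : 'M[K]_2) (v : nat -> 'cV[K]_2) q d :
    A ^+ 2 = q *: A - d%:M -> A *m v 0%N = v 1%N ->
    (forall k, v k.+2 = q *: v k.+1 - d *: v k) ->
  forall k, A ^+ k *m v 0%N = v k.
Proof.
move=> A2 v01 vrec.
have step k : A *m v k = v k.+1.
  elim: k => // k IHk; rewrite vrec -IHk mulmxA.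
  rewrite -[A *m A]/(A ^+ 2) A2 mulmxBl -scalemxAl mul_scalar_mx; congr (_ - _).
elim=> [|k IHk]; first by rewrite expr0 mul1mx.
by rewrite exprS -mulmxA IHk step.
Qed.

(** The explicit form of R: the second row is the identity for Q of a mediant,
    and the first row is then forced by trace q and determinant d. *)
Definition half_crossing n q d := mx2 n (- (n ^+ 2 - n * q + d) / q) q (q - n).

Lemma half_crossing_sqr n q d : q != 0 ->
  half_crossing n q d ^+ 2 = q *: half_crossing n q d - d%:M.
Proof.
move=> q0; apply: mx2_ext; rewrite mulmx2E !mxE /=; by field.
Qed.

(** The matrix on the right is the crossing loop at w; its entries are those of
    q H - d, up to the factor -d. *)
Lemma half_crossing_sqr_loop n q d : q != 0 -> d != 0 ->
  half_crossing n q d ^+ 2 =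
    - d *: (d^-1 *: mx2 (- n * q + d)  (n ^+ 2 - n * q + d)
                        (- q ^+ 2)     (- q ^+ 2 + n * q + d)).
Proof.
move=> q0 d0; rewrite half_crossing_sqr //.
apply: mx2_ext; rewrite !mxE /= ?mulr1n ?mulr0n;
  by field; rewrite ?q0 ?d0.
Qed.

(** The adjugate q - H has the trace and determinant of H, hence satisfies the
    same quadratic equation. *)
Lemma half_crossing_adj_sqr n q d : q != 0 ->
  (q%:M - half_crossing n q d) ^+ 2 = q *: (q%:M - half_crossing n q d) - d%:M.
Proof.
move=> q0; apply: mx2_ext; rewrite mulmx2E !mxE /= ?mulr1n ?mulr0n; by field.
Qed.

Lemma det_half_crossing n q d : q != 0 -> \det (half_crossing n q d) = d.
Proof.
move=> q0; rewrite det_mx22 !mxE /=; by field.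
Qed.

(** Here (n, q), (n0, q0) and (n1, q1) are the values at w, beta_0 and their
    mediant beta_1; the hypotheses are two of the triangle identities there. *)
Lemma half_crossing_forward n q d n0 q0 n1 q1 : q != 0 ->
    q1 = q * q0 - (n * q0 - n0 * q) -> n * q1 - n1 * q = d * q0 ->
  half_crossing n q d *m vec2 n0 q0 = vec2 n1 q1.
Proof.
move=> qN0 q1E cr.
have n1E : n1 = (n * q1 - d * q0) / q by rewrite -cr; field.
by apply: cV2_ext; rewrite mulmx2E !mxE /= ?n1E q1E; field.
Qed.

(** With F0 and F1 the given columns, Y = (-d F0 | F1) and
    Y X = (-d F1 | q F1 - d F0); this is H Y because H F1 = H^2 F0. *)
Lemma half_crossing_conj n q d n0 q0 n1 q1 : q != 0 ->
    half_crossing n q d *m vec2 n0 q0 = vec2 n1 q1 ->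
    d * (n1 * q0 - n0 * q1) != 0 ->
  let Y := mx2 (- d * n0) n1 (- d * q0) q1 in
  Y *m mx2 0 1 (- d) q *m invmx Y = half_crossing n q d.
Proof.
move=> qN0 HF detY Y.
have Yu : Y \in unitmx.
  rewrite unitmxE det_mx22 unitfE !mxE /=.
  by move: detY; congr (_ != 0); ring.
suff -> : Y *m mx2 0 1 (- d) q = half_crossing n q d *m Y by rewrite mulmxK.
have n1E := congr1 (fun v : 'cV_2 => v 0 0) HF.
have q1E := congr1 (fun v : 'cV_2 => v 1 0) HF.
move: n1E q1E; rewrite /Y !mulmx2E !mxE /= => <- <-.
by apply: mx2_ext; rewrite !mulmx2E !mxE /=; field.
Qed.

(** Here (na, qa) are the values at beta_(-1), and da, db are the values of d at
    beta_(-1) and beta_0.  The shift of na by qa is what makes the value of V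
    jump by -1 when j becomes negative. *)
Lemma half_crossing_backward n q d n0 q0 na qa da db : q != 0 -> d = da * db ->
    n * q0 - n0 * q = db * qa -> na * q - n * qa = da * q0 ->
  half_crossing n q d *m vec2 (na - qa) qa = da *: vec2 n0 q0.
Proof.
move=> qN0 dE crr crl.
have naE : na = (n * qa + da * q0) / q by rewrite -crl; field.
have n0E : n0 = (n * q0 - db * qa) / q by rewrite -crr; field.
by apply: cV2_ext; rewrite mulmx2E !mxE /= naE ?n0E ?dE; field.
Qed.

Lemma half_crossing_unit n q d : q != 0 -> d != 0 ->
  half_crossing n q d \in unitmx.
Proof. by move=> q0 d0; rewrite unitmxE det_half_crossing // unitfE. Qed.

Lemma invr_half_crossing n q d : q != 0 -> d != 0 ->
  (half_crossing n q d)^-1 = d^-1 *: (q%:M - half_crossing n q d).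
Proof.
move=> qN0 dN0; set H := half_crossing n q d.
have Hu : H \is a GRing.unit by apply: half_crossing_unit.
apply: (mulrI Hu); rewrite divrr // -scalerAr mulrBr.
rewrite -[H * H]/(H ^+ 2) half_crossing_sqr // -[H * q%:M]/(H *m q%:M).
by rewrite mul_mx_scalar opprB addrC subrK scale_scalar_mx mulVf.
Qed.

Lemma moebius_half_crossing_pow n q d (v : nat -> 'cV[K]_2) : q != 0 ->
    v 0%N 1 0 != 0 -> half_crossing n q d *m v 0%N = v 1%N ->
    (forall k, v k.+2 = q *: v k.+1 - d *: v k) ->
  forall k, moebius (half_crossing n q d ^+ k) (point (v 0%N)) = point (v k).
Proof.
move=> qN0 v0N0 v01 vrec k; rewrite moebius_point //.
by rewrite (pow_mulmx_recurrence (half_crossing_sqr n d qN0) v01 vrec).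
Qed.

(** As H^(-1) is 1/d times the adjugate q - H, which satisfies the same quadratic
    equation as H, inverse powers of H move along a sequence that obeys the
    same recurrence. *)
Lemma moebius_half_crossing_negpow n q d c (u : 'cV[K]_2)
    (v : nat -> 'cV[K]_2) (H := half_crossing n q d) :
    q != 0 -> d != 0 -> c != 0 -> u 1 0 != 0 ->
    H *m v 0%N = c *: u -> (q%:M - H) *m v 0%N = v 1%N ->
    (forall k, v k.+2 = q *: v k.+1 - d *: v k) ->
  forall k, moebius (H ^- k.+1) (point u) = point (v k).
Proof.
move=> qN0 dN0 cN0 u0 Hv0 v01 vrec k; rewrite moebius_point //.
have -> : u = c^-1 *: (H *m v 0%N) by rewrite Hv0 scalerA mulVf // scale1r.
rewrite -exprVn exprSr -scalemxAr mulmxA -(mulmxA (H^-1 ^+ k)).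
rewrite mulVmx ?half_crossing_unit // mulmx1 invr_half_crossing //.
rewrite exprZn -scalemxAl.
rewrite (pow_mulmx_recurrence (half_crossing_adj_sqr n d qN0) v01 vrec).
by rewrite !pointZ ?expf_neq0 ?invr_eq0.
Qed.

Lemma point_vec2 x y : point (vec2 x y) = proj_ratio x y.
Proof. by rewrite /point !mxE. Qed.

Lemma point_vec2_shift x y :
  point (vec2 (x - y) y) = omap (fun t => -1 + t) (point (vec2 x y)).
Proof.
rewrite !point_vec2 /proj_ratio; case: eqP => //= /eqP y0.
by congr Some; field.
Qed.

End Mx2.

HB.instance Definition _ := GRing.RMorphism.copy toQx
  (@tofrac {poly rat} \o map_poly intr).

Lemma toQx_eq0 p : (toQx p == 0) = (p == 0).
Proof.
rewrite tofrac_eq0 -(inj_eq (map_inj_poly (@intr_inj rat) (rmorph0 _))).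
by rewrite rmorph0.
Qed.

(** * The theorem *)

Lemma dQ_frac_neq0 a b : (0 < b)%N -> coprime a b -> dQ (fracpt a b) != 0.
Proof.
move=> b0 cop; rewrite dQ_frac //; apply/eqP => /(congr1 (coefp b))/eqP.
by rewrite /= coefZ coefXn eqxx mulr1 coef0 signr_eq0.
Qed.

(** Dividing H by a square root s of its determinant divides H^2 by s^2 = det H,
    which turns H^2 = -(det H) S into S = -(H/s)^2. *)
Lemma half_crossing_normalized (K L : fieldType) (iota : {rmorphism K -> L})
    (H S : 'M[K]_2) (s : L) :
  H ^+ 2 = - \det H *: S -> \det H != 0 -> s ^+ 2 = iota (\det H) ->
  let H1 := s^-1 *: map_mx iota H in
  [/\ \det H1 = 1, \det S = 1 & map_mx iota S = - H1 ^+ 2].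
Proof.
move=> H2 dN0 s2 H1; set d := \det H in H2 dN0 s2.
have sN0 : s != 0 by rewrite -sqrf_eq0 s2 fmorph_eq0.
have SE : S = (- d)^-1 *: H ^+ 2.
  by rewrite H2 scalerA mulVf ?oppr_eq0 // scale1r.
split.
- by rewrite detZ det_map_mx -/d -s2; field.
- rewrite SE detZ -[H ^+ 2]/(H *m H) det_mulmx -/d. by field; rewrite oppr_eq0.
- rewrite /H1 SE map_mxZ exprZn -[_ ^+ 2]/(_ *m _) map_mxM.
  rewrite -[map_mx iota H ^+ 2]/(_ *m _) -scaleNr.
  by rewrite fmorphV rmorphN -s2 invrN exprVn.
Qed.

Theorem theorem6p6 (Q N : option rat -> {poly int}) (hQN : is_QN Q N)
    (w bm1 b0 : rat) (hw : 0 < w <= 1 / 2) (hc : corners w bm1 b0) :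
  let beta := beta_seq w bm1 b0 in
  let R := R_mx Q N w bm1 b0 in
  let S := S_mx Q N w in
  [/\ (* as Moebius transformations *)
      moebius (R ^+ 2) =1 moebius S,
      (forall j : int,
        moebius (R ^ j) (VV Q N (beta 0)) =
          if 0 <= j then VV Q N (beta j)
          else omap (fun t : Qx => -1 + t) (VV Q N (beta j))),
      (* as matrices of determinant one, over any extension field of QQ(x)
         containing a square root of the determinant of R *)
      (forall (L : fieldType) (iota : {rmorphism Qx -> L}) (s : L),
        s ^+ 2 = iota (\det R) ->
        let R1 : 'M[L]_2 := s^-1 *: map_mx iota R in
        [/\ \det R1 = 1, \det S = 1 & map_mx iota S = - R1 ^+ 2]) &
      (* as the matrix representatives themselves *)
      R ^+ 2 = - toQx (dQ (Some w)) *: S].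
Proof.
move=> beta R S.
have [a [b [c [e [abcd bm1E b0E wE]]]]] := corners_frac hc.
have mcd := farey_lt_right_half abcd; have abm := farey_lt_left_half abcd.
have tri := farey_triangle hQN abcd.
have trir := farey_triangle hQN mcd.
have dwE := dQ_mediant abcd.
have nbr_b0 : neighbours (Some b0) (Some w).
  by rewrite b0E wE; exact: NeighbourLeft mcd.
have nbr_bm1 : neighbours (Some bm1) (Some w).
  by rewrite bm1E wE; exact: NeighbourRight abm.
have b1E : oplus (Some b0) (Some w) = fracpt (a + c + c) (b + e + e).
  by rewrite oplusC wE b0E (farey_lt_oplus mcd).
have [cop_w _] := farey_lt_coprime mcd.
have [wpos _ _ _ _] := mcd.
have := dQ_frac_neq0 wpos cop_w.
move: tri trir dwE; rewrite -b1E -wE -bm1E -b0E => tri trir dwE dwN0.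
pose vF g := vec2 (toQx (N g)) (toQx (Q g)).
pose vF' g := vec2 (toQx (N g) - toQx (Q g)) (toQx (Q g)).
pose d := toQx (dQ (Some w)); pose q := toQx (Q (Some w)).
pose n := toQx (N (Some w)).
have Qneq0 p : p.[0] = 1 -> toQx p != 0.
  move=> p0; rewrite toQx_eq0; apply: contraPneq p0 => ->.
  by rewrite horner0 => /eqP; rewrite eq_sym oner_eq0.
have qN0 : q != 0 by apply: Qneq0; case: tri.
have dN0 : d != 0 by rewrite toQx_eq0.
have q0N0 : toQx (Q (Some b0)) != 0 by apply: Qneq0; case: tri.
have dE : d = toQx (dQ (Some bm1)) * toQx (dQ (Some b0)).
  by rewrite -rmorphM -dwE.
pose H := half_crossing n q d.
have HF : H *m vF (Some b0) = vF (oplus (Some b0) (Some w)).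
  apply: (half_crossing_forward qN0).
    by rewrite -!(rmorphM, rmorphB); congr toQx; apply: Q_mediant trir.
  by rewrite -!(rmorphM, rmorphB); congr toQx; apply: cross_left trir.
have RE : R = H.
  rewrite /R /R_mx /Y_mx /X_mx -/d -/q /=.
  apply: (half_crossing_conj qN0 HF).
  apply: (mulf_neq0 dN0).
  rewrite -!(rmorphM, rmorphB) -/(cross Q N _ _) (cross_right trir) rmorphM.
  apply: mulf_neq0 qN0.
  by apply: contraNneq dN0 => db0; rewrite dE db0 mulr0.
have HG : H *m vF' (Some bm1) = toQx (dQ (Some bm1)) *: vF (Some b0).
  apply: (half_crossing_backward qN0 dE).
    by rewrite -!(rmorphM, rmorphB); congr toQx; apply: cross_right tri.
  by rewrite -!(rmorphM, rmorphB); congr toQx; apply: cross_left tri.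
have daN0 : toQx (dQ (Some bm1)) != 0.
  by apply: contraNneq dN0 => da0; rewrite dE da0 mul0r.
(* Both fans around w obey one recursion, with coefficients from w alone. *)
have recF F k b' : farey_recursive Q F -> neighbours b' (Some w) ->
    toQx (F (oplusn b' k.+2 (Some w))) =
    q * toQx (F (oplusn b' k.+1 (Some w))) - d * toQx (F (oplusn b' k (Some w))).
  move=> Frec nbr; have := neighbours_rec Frec (neighbours_oplusn k nbr).
  by rewrite /= => ->; rewrite rmorphD !rmorphM rmorphN mulNr addrC.
have [_ _ _ _ _ _ Qrec Nrec] := hQN.
have H2 : H ^+ 2 = - d *: S.
  exact: (half_crossing_sqr_loop n qN0 dN0).
have recvF k : vF (oplusn (Some b0) k.+2 (Some w)) =
    q *: vF (oplusn (Some b0) k.+1 (Some w)) -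
    d *: vF (oplusn (Some b0) k (Some w)).
  apply: cV2_ext; rewrite !mxE /=.
    exact: recF Nrec nbr_b0.
  exact: recF Qrec nbr_b0.
have recvF' k : vF' (oplusn (Some bm1) k.+2 (Some w)) =
    q *: vF' (oplusn (Some bm1) k.+1 (Some w)) -
    d *: vF' (oplusn (Some bm1) k (Some w)).
  apply: cV2_ext; rewrite !mxE /= (recF Q k _ Qrec nbr_bm1) //.
  by rewrite (recF N k _ Nrec nbr_bm1); ring.
have adjG : (q%:M - H) *m vF' (Some bm1) = vF' (oplus (Some bm1) (Some w)).
  rewrite mulmxBl HG mul_scalar_mx.
  have crl : q * toQx (N (Some bm1)) =
      toQx (dQ (Some bm1)) * toQx (Q (Some b0)) + n * toQx (Q (Some bm1)).
    apply/eqP; rewrite -subr_eq mulrC; apply/eqP.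
    by rewrite -!(rmorphM, rmorphB); congr toQx; apply: cross_left tri.
  (* The recursion at w does not reach the first two terms of the left fan:
     beta_(-2), the mediant of beta_(-1) and w, is obtained from beta_0 by
     adding beta_(-1) twice. *)
  have recG F : farey_recursive Q F -> toQx (F (oplus (Some bm1) (Some w))) =
      - toQx (dQ (Some bm1)) * toQx (F (Some b0)) +
      toQx (Q (Some bm1)) * toQx (F (Some w)).
    move=> Frec; have := rec_towards_left Frec abcd.
    rewrite -(farey_lt_oplus abm) -wE -bm1E -b0E => ->.
    by rewrite rmorphD !rmorphM rmorphN.
  apply: cV2_ext; rewrite !mxE /= (recG Q Qrec) -/n -/q.
    by rewrite (recG N Nrec) -/n mulrBr crl; ring.
  by ring.
have vF0 : vF (Some b0) 1 0 != 0 by rewrite mxE /=; exact: q0N0.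
have dH : \det H = d := det_half_crossing n d qN0.
split.
- rewrite RE H2; apply: moebiusZ; rewrite oppr_eq0; exact: dN0.
- move=> j; rewrite RE /VV -!point_vec2; case: j => k.
    exact: (moebius_half_crossing_pow
      (v := fun k => vF (oplusn (Some b0) k (Some w))) qN0 vF0 HF recvF).
  rewrite /= -point_vec2_shift.
  exact: (moebius_half_crossing_negpow
    (v := fun k => vF' (oplusn (Some bm1) k (Some w)))
    qN0 dN0 daN0 vF0 HG adjG recvF').
- move=> L iota s; rewrite RE => s2.
  by apply: (half_crossing_normalized _ _ s2); rewrite dH;
    [exact: H2|exact: dN0].
- by rewrite RE; exact: H2.
Qed.
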